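(* Let $0<p,q<\infty$ and $0<\alpha,\beta\le 1$. Consider the function $$\tau(p)=\begin{cases}1 & \text{if } 0<p\le 1,\\ p & \text{if } 1\le p\le 2,\\ 2 & \text{if } p\ge 2.\end{cases}$$ If $\dfrac{\tau(p)}{\tau(q)}<\dfrac{\alpha}{\beta}$, then $\ell_p^{(\alpha)}=(\ell_p,d_p^{\alpha})$ does not Lipschitz embed into $L_q^{(\beta)}=(L_q,d_q^{\beta})$. In particular, the spaces $(L_p,d_p)$ and $(\ell_p,d_p)$ belong to the class $\mathsf{NS}_{\mathsf T}$ for all $0<p<\infty$.
   Context: $L_p=L_p[0,1]$ (real). For $0<p\le 1$, $d_p$ denotes the metric $d_p(x,y)=\sum_{n}|x_n-y_n|^p$ on $\ell_p$ and $d_p(f,g)=\int_0^1|f(t)-g(t)|^p\,dt$ on $L_p$; for $p\ge 1$, $d_p$ denotes the usual norm metric on $\ell_p$, respectively $L_p$. For a metric space $(\mathcal M,d)$ and $0<s\le 1$, $\mathcal M^{(s)}=(\mathcal M,d^s)$, where $d^s(x,y)=d(x,y)^s$. A metric space $(\mathcal M_1,d_1)$ Lipschitz embeds into $(\mathcal M_2,d_2)$ if there are a one-to-one map $f:\mathcal M_1\to\mathcal M_2$ and constants $A,B>0$ with $A^{-1}d_1(x,y)\le d_2(f(x),f(y))\le B\,d_1(x,y)$ for all $x,y\in\mathcal M_1$. The class $\mathsf{NS}_{\mathsf T}$ consists of all metric spaces $(\mathcal M,d)$ such that $(\mathcal M,d)$ does not Lipschitz embed into $(\mathcal M,d^s)$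 for any $0<s<1$. *)

(* Defs.v *)
From HB Require Import structures.
From mathcomp Require Import all_boot all_order all_algebra finmap.
From mathcomp Require Import all_classical all_reals all_analysis measurable_realfun.

Set Implicit Arguments.
Unset Strict Implicit.
Unset Printing Implicit Defensive.

Import Order.TTheory GRing.Theory Num.Theory.
Import numFieldNormedType.Exports.

Local Open Scope classical_set_scope.
Local Open Scope ring_scope.

Section powR_facts.
Context {R : realType}.
Implicit Types a b p : R.

Lemma powR_subadd a b p : 0 <= a -> 0 <= b -> 0 < p -> p <= 1 ->
  (a + b) `^ p <= a `^ p + b `^ p.
Proof.
move=> a0 b0 p0 p1; have [ab0|abN0] := eqVneq (a + b) 0.
  by rewrite ab0 powR0 ?gt_eqF// addr_ge0// powR_ge0.
have ab : 0 < a + b by rewrite lt_neqAle eq_sym abN0 addr_ge0.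
have key c : 0 <= c -> c <= a + b -> c / (a + b) * (a + b) `^ p <= c `^ p.
  move=> c0 cab; have [->|cN0] := eqVneq c 0; first by rewrite !mul0r powR_ge0.
  have cpos : 0 < c by rewrite lt_neqAle eq_sym cN0.
  have cabE : c `^ p = (c / (a + b)) `^ p * (a + b) `^ p.
    rewrite -powRM ?divr_ge0 ?addr_ge0//.
    by rewrite divfK.
  rewrite cabE ler_wpM2r ?powR_ge0// ger1_powR//.
  by rewrite divr_gt0//= ler_pdivrMr// mul1r.
have -> : (a + b) `^ p = a / (a + b) * (a + b) `^ p + b / (a + b) * (a + b) `^ p.
  by rewrite -mulrDl -mulrDl divff// mul1r.
by apply: lerD; apply: key => //; rewrite ?lerDl ?lerDr.
Qed.

End powR_facts.

Section snowflake.
Context {R : realType}.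

Definition snowflake (s : R) (s_gt0 : 0 < s) (s_le1 : s <= 1)
  (M : metricType R) : Type := M.

Section metric.
Context (s : R) (s_gt0 : 0 < s) (s_le1 : s <= 1) (M : metricType R).

Definition snowflake_dist (x y : snowflake s_gt0 s_le1 M) : R :=
  (@mdist R M x y) `^ s.

Let dxx x : snowflake_dist x x = 0.
Proof. by rewrite /snowflake_dist mdistxx powR0// gt_eqF. Qed.

Let d_positivity x y : snowflake_dist x y = 0 -> x = y.
Proof. by move=> /powR_eq0_eq0 /mdist_positivity. Qed.

Let d_sym x y : snowflake_dist x y = snowflake_dist y x.
Proof. by rewrite /snowflake_dist metric_sym. Qed.

Let d_triangle y x z : snowflake_dist x z <= snowflake_dist x y + snowflake_dist y z.
Proof.
apply: le_trans (powR_subadd _ _ s_gt0 s_le1); rewrite ?mdist_ge0//.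
apply: ge0_ler_powR; rewrite ?nnegrE ?addr_ge0 ?mdist_ge0 ?(ltW s_gt0)//.
exact: metric_triangle.
Qed.

HB.instance Definition _ := Choice.copy (snowflake s_gt0 s_le1 M) M.
HB.instance Definition _ := @isMetric.Build R (snowflake s_gt0 s_le1 M)
  snowflake_dist dxx d_positivity d_sym d_triangle.

Lemma snowflake_mdistE (x y : snowflake s_gt0 s_le1 M) :
  mdist x y = (@mdist R M x y) `^ s.
Proof. by []. Qed.

End metric.

End snowflake.

Definition lipschitz_embeds {R : realType} (M1 M2 : metricType R) : Prop :=
  exists2 f : M1 -> M2, injective f &
    exists A B : R, [/\ 0 < A, 0 < B &
      forall x y : M1,
        A^-1 * mdist x y <= mdist (f x) (f y) /\
        mdist (f x) (f y) <= B * mdist x y].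

Definition NS_T {R : realType} (M : metricType R) : Prop :=
  forall (s : R) (s_gt0 : 0 < s) (s_lt1 : s < 1),
    ~ lipschitz_embeds M (snowflake s_gt0 (ltW s_lt1) M).

(* From the sum, or integral, [S] of the p-th powers of |x - y| to d_p(x, y):
   a p-th root is taken only when p >= 1. *)
Definition proot {R : realType} (p : R) (S : \bar R) : R :=
  if p <= 1 then fine S else fine S `^ p^-1.

Section mass.
Context d (T : measurableType d) {R : realType}.
Context (mu : {measure set T -> \bar R}) (p : R) (p_gt0 : 0 < p).
Implicit Types f g : T -> R.
Local Open Scope ereal_scope.

Let mass f : \bar R := \int[mu]_t (`|f t| `^ p)%:E.

Let measurable_mass f : measurable_fun setT f ->
  measurable_fun setT (fun t => (`|f t| `^ p)%:E).
Proof.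
move=> mf; apply/measurable_EFinP.
apply: (@measurableT_comp _ _ _ _ _ _ (@powR R ^~ p)) => //.
exact: measurableT_comp.
Qed.

Let mass_ge0 f : 0 <= mass f.
Proof. by apply: integral_ge0 => t _; rewrite lee_fin powR_ge0. Qed.

Let massE f : mass f = 'N[mu]_p%:E[EFin \o f] `^ p.
Proof. by rewrite poweR_Lnorm ?gt_eqF. Qed.

Let LnormE f : 'N[mu]_p%:E[EFin \o f] = mass f `^ p^-1.
Proof. by rewrite unlock. Qed.

Let mass_subadd f g : measurable_fun setT f -> measurable_fun setT g ->
  (p <= 1)%R -> mass (f \+ g)%R <= mass f + mass g.
Proof.
move=> mf mg p1; rewrite -ge0_integralD//; [|exact: measurable_mass..].
apply: ge0_le_integral => //.
- by apply: measurable_mass; exact: measurable_funD.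
- by apply: emeasurable_funD; exact: measurable_mass.
- move=> t _; rewrite -EFinD lee_fin.
  apply: le_trans (powR_subadd _ _ p_gt0 p1) => //.
  by apply: ge0_ler_powR; rewrite ?nnegrE ?addr_ge0// ?(ltW p_gt0)// ler_normD.
Qed.

Let Lnorm_lty f : mass f < +oo -> 'N[mu]_p%:E[EFin \o f] < +oo.
Proof. by move=> fy; rewrite LnormE poweR_lty. Qed.

Lemma massD_lty f g : measurable_fun setT f -> measurable_fun setT g ->
  mass f < +oo -> mass g < +oo -> mass (f \+ g)%R < +oo.
Proof.
move=> mf mg fy gy; have [p1|p1] := leP p 1%R.
  by apply: le_lt_trans (mass_subadd mf mg p1) _; rewrite lte_add_pinfty.
rewrite massE poweR_lty//.
apply: le_lt_trans (minkowski_EFin _ mf mg (ltW p1)) _.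
by rewrite lte_add_pinfty// Lnorm_lty.
Qed.

Lemma massN f : mass (\- f)%R = mass f.
Proof. by apply: eq_integral => t _ /=; rewrite normrN. Qed.

Lemma massB_lty f g : measurable_fun setT f -> measurable_fun setT g ->
  mass f < +oo -> mass g < +oo -> mass (f \- g)%R < +oo.
Proof.
by move=> mf mg fy gy; apply: massD_lty; rewrite ?massN//; exact: measurable_funN.
Qed.

Lemma massBC f g : mass (f \- g)%R = mass (g \- f)%R.
Proof. by apply: eq_integral => t _ /=; rewrite distrC. Qed.

Lemma prootD f g : measurable_fun setT f -> measurable_fun setT g ->
  mass f < +oo -> mass g < +oo ->
  (proot p (mass (f \+ g)) <= proot p (mass f) + proot p (mass g))%R.
Proof.
move=> mf mg fy gy; have fgy := massD_lty mf mg fy gy.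
have fin h : mass h < +oo -> mass h \is a fin_num by move=> ?; rewrite ge0_fin_numE.
rewrite /proot; have [p1|p1] := leP p 1%R.
  rewrite -lee_fin EFinD !fineK ?fin//; exact: mass_subadd.
have := minkowski_EFin mu mf mg (ltW p1); rewrite !LnormE.
by rewrite -(fineK (fin _ fgy)) -(fineK (fin _ fy)) -(fineK (fin _ gy)) !poweR_EFin.
Qed.

Lemma proot_eq0 f : measurable_fun setT f -> mass f < +oo ->
  proot p (mass f) = 0%R -> f = cst 0%R %[ae mu].
Proof.
move=> mf fy f0.
have {}f0 : fine (mass f) = 0%R.
  by move: f0; rewrite /proot; case: leP => // _ /powR_eq0_eq0.
have m0 : mass f = 0 by rewrite -(@fineK _ (mass f)) ?f0// ge0_fin_numE.
have /measurable_EFinP mf' := mf.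
have : 'N[mu]_p%:E[EFin \o f] = 0.
  by rewrite LnormE m0 poweR0r// invr_eq0 gt_eqF.
move=> /(Lnorm_eq0_eq0 mf'); rewrite lte_fin => /(_ p_gt0).
by apply: filterS => t /(_ I) [].
Qed.

Lemma proot0 : proot p (mass (cst 0%R)) = 0%R.
Proof.
have -> : mass (cst 0%R) = 0.
  by rewrite /mass; under eq_integral do rewrite normr0 powR0 ?gt_eqF//;
    rewrite integral0.
by rewrite /proot/=; case: ifP => // _; rewrite powR0// invr_eq0 gt_eqF.
Qed.

End mass.

Section ellp.
Context {R : realType}.

Record ellp (p : R) (p_gt0 : 0 < p) := Ellp {
  ellp_seq :> nat -> R ;
  ellp_summable : (\sum_(n <oo) (`|ellp_seq n| `^ p)%:E < +oo)%E }.

Section metric.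
Context (p : R) (p_gt0 : 0 < p).
Implicit Types x y z : ellp p_gt0.

HB.instance Definition _ := gen_eqMixin (ellp p_gt0).
HB.instance Definition _ := gen_choiceMixin (ellp p_gt0).

Definition ellp_dist x y : R :=
  proot p (\sum_(n <oo) (`|x n - y n| `^ p)%:E)%E.

Let massE (u : nat -> R) : (\sum_(n <oo) (`|u n| `^ p)%:E)%E =
  (\int[counting]_n (`|u n| `^ p)%:E)%E.
Proof. by rewrite ge0_integral_count// => n; rewrite lee_fin powR_ge0. Qed.

Let dE x y :
  ellp_dist x y = proot p (\int[counting]_n (`|(x \- y) n| `^ p)%:E)%E.
Proof. by rewrite /ellp_dist (massE (x \- y)). Qed.

Let mass_lty x : (\int[counting]_n (`|x n| `^ p)%:E < +oo)%E.
Proof. by rewrite -massE ellp_summable. Qed.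

Let dxx x : ellp_dist x x = 0.
Proof.
rewrite dE (_ : (x \- x) = cst 0) ?proot0//.
by apply/funext => n /=; rewrite subrr.
Qed.

Let d_positivity x y : ellp_dist x y = 0 -> x = y.
Proof.
rewrite dE => /(@proot_eq0 _ _ _ _ _ p_gt0 (x \- y)) xy.
have {xy} [A [_ A0 xyA]] : x \- y = cst 0 %[ae (@counting nat R)].
  by apply: xy => //; exact: massB_lty.
have AE : A = set0.
  move: A0; rewrite /counting/=; case: ifPn => [/asboolP fA [/eqP]|//].
  by rewrite pnatr_eq0 cardfs_eq0 => /eqP /(fset_set_set0 fA).
suff xy : ellp_seq x = ellp_seq y.
  case: x y xy {xyA} => [u hu] [v hv] /= uv; rewrite uv in hu *.
  by congr Ellp; exact: Prop_irrelevance.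
apply/funext => n; apply: contrapT => xyn.
suff : A n by rewrite AE.
by apply: xyA => /= /(_ I) /= /eqP; rewrite subr_eq0 => /eqP.
Qed.

Let d_sym x y : ellp_dist x y = ellp_dist y x.
Proof. by rewrite !dE massBC. Qed.

Let d_triangle y x z : ellp_dist x z <= ellp_dist x y + ellp_dist y z.
Proof.
rewrite !dE (_ : x \- z = (x \- y) \+ (y \- z)).
  by apply: prootD => //; exact: massB_lty.
by apply/funext => n /=; rewrite addrA subrK.
Qed.

HB.instance Definition _ := @isMetric.Build R (ellp p_gt0)
  ellp_dist dxx d_positivity d_sym d_triangle.

Lemma ellp_mdistE x y : mdist x y = ellp_dist x y. Proof. by []. Qed.

End metric.

End ellp.

(* Functions on [0, 1] are represented by functions on the whole line, modulo
   equality almost everywhere for this measure. *)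
Definition lebesgue01 (R : realType) : {measure set (measurableTypeR R) -> \bar R} :=
  mrestr (@lebesgue_measure R) (measurable_itv `[0%R, 1%R]).

Section Lp.
Context {R : realType}.

(* [{mfun_ mu, T >-> U}] consists of almost-everywhere classes, which coerce
   to a chosen representative. *)
Record Lp (p : R) (p_gt0 : 0 < p) := MkLp {
  Lp_class :> {mfun_(lebesgue01 R), measurableTypeR R >-> measurableTypeR R} ;
  Lp_integrable :
    (\int[lebesgue01 R]_t (`|(Lp_class t : R)| `^ p)%:E < +oo)%E }.

Section metric.
Context (p : R) (p_gt0 : 0 < p).
Implicit Types f g h : Lp p_gt0.

HB.instance Definition _ := gen_eqMixin (Lp p_gt0).
HB.instance Definition _ := gen_choiceMixin (Lp p_gt0).

Definition Lp_dist f g : R :=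
  proot p (\int[lebesgue01 R]_t (`|(f t : R) - g t| `^ p)%:E)%E.

Let fct f : measurableTypeR R -> R := f.

Let mfct f : measurable_fun setT (fct f).
Proof. exact: (measurable_funPT (repr (Lp_class f))). Qed.

Let dE f g :
  Lp_dist f g = proot p (\int[lebesgue01 R]_t (`|(fct f \- fct g) t| `^ p)%:E)%E.
Proof. by []. Qed.

Let mass_lty f : (\int[lebesgue01 R]_t (`|fct f t| `^ p)%:E < +oo)%E.
Proof. exact: Lp_integrable. Qed.

Let dxx f : Lp_dist f f = 0.
Proof.
rewrite dE (_ : fct f \- fct f = cst 0) ?proot0//.
by apply/funext => n /=; rewrite subrr.
Qed.

Let d_positivity f g : Lp_dist f g = 0 -> f = g.
Proof.
rewrite dE => /(proot_eq0 p_gt0) fg0.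
have {fg0} fg : fct f \- fct g = cst 0 %[ae lebesgue01 R].
  by apply: fg0; [exact: measurable_funB|exact: massB_lty].
suff fgE : Lp_class f = Lp_class g.
  case: f g fgE {fg} => [u hu] [v hv] /= uv; rewrite uv in hu *.
  by congr MkLp; exact: Prop_irrelevance.
rewrite -[LHS]reprK -[RHS]reprK; apply/eqP/ae_eqP.
by apply: filterS fg => t /[apply] /= /eqP; rewrite subr_eq0 => /eqP.
Qed.

Let d_sym f g : Lp_dist f g = Lp_dist g f.
Proof. by rewrite !dE massBC. Qed.

Let d_triangle g f h : Lp_dist f h <= Lp_dist f g + Lp_dist g h.
Proof.
rewrite !dE (_ : fct f \- fct h = (fct f \- fct g) \+ (fct g \- fct h)).
  by apply: prootD => //; [exact: measurable_funB|exact: measurable_funB|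
    exact: massB_lty|exact: massB_lty].
by apply/funext => n /=; rewrite addrA subrK.
Qed.

HB.instance Definition _ := @isMetric.Build R (Lp p_gt0)
  Lp_dist dxx d_positivity d_sym d_triangle.

Lemma Lp_mdistE f g : mdist f g = Lp_dist f g. Proof. by []. Qed.

End metric.

End Lp.

Definition tau {R : realType} (p : R) : R :=
  if p <= 1 then 1 else if p <= 2 then p else 2.

(* Main.v *)
Require Import Defs.
From mathcomp Require Import all_boot all_order all_algebra.
From mathcomp Require Import all_classical all_reals all_analysis measurable_realfun.
From mathcomp Require Import ring lra.

(** Two quantities are compared on Hamming cubes, whose vertices are words of
   booleans and whose diagonals join a word to its bitwise negation.

   On the one hand, [ell_p] and [L_p] contain, for every [n], an [n]-cube with
   edges of length at most [1] and all diagonals of length at least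
   [n ^ (1 / tau p)]: the 0/1 vectors of [ell_p^n] for [p <= 2], and Rademacher
   sums with 0/1 coefficients for [p > 2], where the [p]-norm dominates the
   Euclidean one ([stretched_cubes_lpN]).

   On the other hand, in [L_q(mu)] a cube with edges at most [b] has some
   diagonal of length at most [C * b * n ^ (1 / tau q)]
   ([antipodal_bound_Lq]).  For [q <= 1] this is the triangle inequality.  For
   [q >= 1], put [Phi u] for the integral of the [q]-th power of [|u|].
   Averaging a cube over its first coordinate gives a cube [g] of one dimension
   less and a cube [h] of half-edges, the vertices of the original one being
   [g + h] and [g - h].  A two-point inequality
   [Phi (u + v) + Phi (u - v) <= 2 * (lam * Phi u + K * Phi v)]
   then bounds the mean of [Phi] around the centre of the cube by
   [n * lam ^ n * K * b] ([cube_poincare]).  The constants are [lam = K = 1]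
   when [q <= 2].  When [q > 2], [lam] is taken of the form [1 + O(1 / n)] so
   that [lam ^ n] stays bounded, at the price of [K] of order [n ^ (q / 2 - 1)],
   which is exactly what the exponent [2] allows ([two_point_tau]).

   A Lipschitz embedding of one snowflake into the other would map the stretched
   cubes of the source to cubes in the target, and comparing the two estimates
   makes [n ^ (alpha / (beta * tau p) - 1 / tau q)] bounded, although its
   exponent is positive ([no_distorted_map]).  The same comparison of a space
   with itself yields membership in [NS_T]. *)

Set Implicit Arguments.
Unset Strict Implicit.
Unset Printing Implicit Defensive.

Import Order.TTheory GRing.Theory Num.Theory.
Import numFieldNormedType.Exports.

Local Open Scope ring_scope.

(** * Power inequalities on the line *)

Section power_inequalities.
Context {R : realType}.
Implicit Types a b p q r x y : R.

Lemma powR_le r x y : 0 <= r -> 0 <= x -> x <= y -> x `^ r <= y `^ r.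
Proof.
move=> r0 x0 xy; apply: ge0_ler_powR => //; rewrite nnegrE//.
exact: le_trans xy.
Qed.

Lemma powR_le_root r x y : 0 < r -> 0 <= x -> 0 <= y ->
  x `^ r <= y -> x <= y `^ r^-1.
Proof.
move=> r0 x0 y0 /(powR_le (r := r^-1)); rewrite powR_ge0 invr_ge0 (ltW r0).
by move=> /(_ isT isT); rewrite -powRrM divff ?gt_eqF// powRr1.
Qed.

Lemma powR_convex r (t x y : R) : 1 <= r -> 0 <= t <= 1 -> 0 <= x -> 0 <= y ->
  (t * x + (1 - t) * y) `^ r <= t * x `^ r + (1 - t) * y `^ r.
Proof.
move=> r1 t01 x0 y0; have /andP[t0 t1] := t01.
have [i tE] : exists i : {i01 R}, i%:inum = t by exists (Itv01 t0 t1).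
rewrite -tE.
have := @convex_powR R r r1 i x y.
rewrite !inE/= !in_itv/= !andbT => /(_ x0 y0).
by rewrite !convRE.
Qed.

Lemma powR_midconvex r x y : 1 <= r -> 0 <= x -> 0 <= y ->
  ((x + y) / 2) `^ r <= (x `^ r + y `^ r) / 2.
Proof.
move=> r1 x0 y0; have t01 : 0 <= (2^-1 : R) <= 1 by apply/andP; split; lra.
have := powR_convex r1 t01 x0 y0.
by rewrite (_ : 1 - 2^-1 = 2^-1) ?(mulrC 2^-1) -?mulrDl//; lra.
Qed.

Lemma powR_midconcave r x y : 0 < r -> r <= 1 -> 0 <= x -> 0 <= y ->
  (x `^ r + y `^ r) / 2 <= ((x + y) / 2) `^ r.
Proof.
move=> r0 r1 x0 y0.
have := @powR_midconvex r^-1 (x `^ r) (y `^ r).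
rewrite invf_ge1// r1 !powR_ge0 -!powRrM divff ?gt_eqF// !powRr1//.
move=> /(_ isT isT isT)/(powR_le_root _); rewrite invrK invr_gt0 r0; apply=> //.
- by rewrite divr_ge0// addr_ge0// powR_ge0.
- by rewrite divr_ge0// addr_ge0.
Qed.

(** This is convexity of the power between the points [x / t] and
   [y / (1 - t)].  For [t] close to [1] the first summand is hardly enlarged. *)
Lemma powRD_weighted r t x y : 1 <= r -> 0 < t < 1 -> 0 <= x -> 0 <= y ->
  (x + y) `^ r <= t^-1 `^ (r - 1) * x `^ r + (1 - t)^-1 `^ (r - 1) * y `^ r.
Proof.
move=> r1 /andP[t0 t1] x0 y0; have u0 : 0 < 1 - t by rewrite subr_gt0.
have key (s z : R) : 0 < s -> 0 <= z -> s * (z / s) `^ r = s^-1 `^ (r - 1) * z `^ r.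
  move=> s0 z0; rewrite powRM// ?invr_ge0 ?(ltW s0)//.
  rewrite mulrCA mulrC; congr (_ * _).
  rewrite -(@mulr_powRB1 _ s^-1 r) ?invr_ge0 ?(ltW s0)//; last exact: lt_le_trans r1.
  by rewrite mulrA divff ?mul1r// gt_eqF.
have t01 : 0 <= t <= 1 by rewrite !ltW.
have := @powR_convex r t (x / t) (y / (1 - t)) r1 t01.
rewrite !divr_ge0 ?(ltW t0) ?(ltW u0)// => /(_ isT isT).
by rewrite !key// ![_ * (_ / _)]mulrC !divfK ?gt_eqF.
Qed.

Lemma sqr_powR_half q a : (a ^+ 2) `^ (q / 2) = `|a| `^ q.
Proof.
by rewrite -real_normK ?num_real// -powR_mulrn// -powRrM mulrCA divff ?mulr1.
Qed.

(** Concavity of the power [q / 2] reduces this to the parallelogram identity. *)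
Lemma two_point_le2 q a b : 0 < q -> q <= 2 ->
  (`|a + b| `^ q + `|a - b| `^ q) / 2 <= (a ^+ 2 + b ^+ 2) `^ (q / 2).
Proof.
move=> q0 q2; rewrite -!sqr_powR_half.
apply: (le_trans (powR_midconcave _ _ _ _)); rewrite ?sqr_ge0//; try lra.
apply: powR_le; first by lra.
  by rewrite divr_ge0// addr_ge0// sqr_ge0.
by rewrite le_eqVlt; apply/orP; left; apply/eqP; field.
Qed.

(** Two-point smoothness of the line.  The exponent is doubled until it exceeds
   [q], starting from [q <= 2]: the squares of [a + b] and [a - b] are again of
   this form, namely [(a ^+ 2 + b ^+ 2) + 2 * a * b] and
   [(a ^+ 2 + b ^+ 2) - 2 * a * b]. *)
Lemma two_point q : 0 < q -> exists2 C : R, 0 < C & forall a b,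
  (`|a + b| `^ q + `|a - b| `^ q) / 2 <= (a ^+ 2 + C * b ^+ 2) `^ (q / 2).
Proof.
move=> q0; have [k qk] : exists k : nat, q <= 2 ^+ k.+1.
  exists (Num.truncn q).+1; rewrite ltW//; apply: (lt_trans (truncnS_gt _)).
  by rewrite -natrX ltr_nat; apply: ltn_trans (ltn_expl _ _).
elim: k q q0 qk => [|k IH] q q0 qk.
  by exists 1 => // a b; rewrite mul1r; exact: two_point_le2.
have [||C C0 HC] := IH (q / 2); first by rewrite divr_gt0.
  by rewrite ler_pdivrMr// -exprSr.
exists (1 + 2 * C) => [|a b]; first by lra.
rewrite -!sqr_powR_half.
have -> : (a + b) ^+ 2 = (a ^+ 2 + b ^+ 2) + 2 * a * b by ring.
have -> : (a - b) ^+ 2 = (a ^+ 2 + b ^+ 2) - 2 * a * b by ring.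
have h0 : 0 <= a ^+ 2 + b ^+ 2 by rewrite addr_ge0 ?sqr_ge0.
have Np : 0 <= a ^+ 2 + b ^+ 2 + 2 * a * b by have := sqr_ge0 (a + b); rewrite sqrrD; lra.
have Nm : 0 <= a ^+ 2 + b ^+ 2 - 2 * a * b by have := sqr_ge0 (a - b); rewrite sqrrB; lra.
have := HC (a ^+ 2 + b ^+ 2) (2 * a * b).
rewrite (ger0_norm Np) (ger0_norm Nm) => /le_trans; apply.
set c := 1 + 2 * C.
have c0 : 0 <= a ^+ 2 + c * b ^+ 2.
  by rewrite addr_ge0 ?sqr_ge0// mulr_ge0 ?sqr_ge0// /c; lra.
have -> : (a ^+ 2 + c * b ^+ 2) `^ (q / 2) =
    ((a ^+ 2 + c * b ^+ 2) ^+ 2) `^ (q / 2 / 2).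
  by rewrite sqr_powR_half ger0_norm.
apply: powR_le; first by lra.
  by rewrite addr_ge0 ?sqr_ge0//; apply: mulr_ge0 (sqr_ge0 _); lra.
have -> : (a ^+ 2 + c * b ^+ 2) ^+ 2 = ((a ^+ 2 + b ^+ 2) ^+ 2 +
    C * (2 * a * b) ^+ 2) + 4 * C * (C + 1) * (b ^+ 2) ^+ 2 by rewrite /c; ring.
rewrite lerDl.
by rewrite mulr_ge0 ?sqr_ge0// !mulr_ge0//; lra.
Qed.

End power_inequalities.

Section two_point_constants.
Context {R : realType}.
Implicit Types a b p q r x y : R.

Lemma tau_le1 q : q <= 1 -> tau q = 1.
Proof. by rewrite /tau => ->. Qed.

Lemma tau_1_2 q : 1 <= q -> q <= 2 -> tau q = q.
Proof.
rewrite /tau => q1 q2; case: ifPn => [q1'|_]; last by rewrite q2.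
by apply/eqP; rewrite eq_le q1 q1'.
Qed.

Lemma tau_ge2 q : 2 <= q -> tau q = 2.
Proof.
rewrite /tau => q2; case: ifPn => [?|_]; first by lra.
by case: ifPn => // ?; apply/eqP; rewrite eq_le; apply/andP; split; lra.
Qed.

Lemma tau_gt0 q : 0 < tau q.
Proof. by rewrite /tau; case: ifPn => // q1; case: ifPn => // q2; lra. Qed.

(** The weight [n / (n + 1)] makes the [n]-th power of
   [lam = (1 + 1 / n) ^ (q / 2 - 1)] bounded by a power of [e], while
   [K = O (n ^ (q / 2 - 1))]; the product [n * lam ^ n * K] is what [n]
   successive applications of the two-point inequality cost. *)
Lemma two_point_tau q : 1 <= q -> exists2 C : R, 0 < C &
  forall n : nat, (0 < n)%N -> exists lam K : R, [/\ 1 <= lam, 0 <= K,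
    n%:R * lam ^+ n * K <= C * n%:R `^ (q / tau q) &
    forall a b, `|a + b| `^ q + `|a - b| `^ q <=
      2 * (lam * `|a| `^ q + K * `|b| `^ q)].
Proof.
move=> q1; have q0 : 0 < q by lra.
have [q2|q2] := leP q 2.
  exists 1 => // n n0; exists 1, 1; split => //.
    by rewrite tau_1_2// divff ?gt_eqF// powRr1// expr1n !mulr1 mul1r.
  move=> a b; rewrite mulrC -ler_pdivrMr// !mul1r.
  apply: le_trans (two_point_le2 _ _ q0 q2) _.
  apply: le_trans (powR_subadd _ _ _ _) _; rewrite ?sqr_ge0//; try lra.
  by rewrite !sqr_powR_half.
have [C C0 HC] := two_point q0.
rewrite tau_ge2 ?(ltW q2)//; set r := q / 2; have r1 : 1 < r by rewrite /r; lra.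
have e0 : 0 <= r - 1 by lra.
exists (expR 1 `^ (r - 1) * 2 `^ (r - 1) * C `^ r).
  by rewrite !mulr_gt0 ?powR_gt0// expR_gt0.
move=> n n0; have n0' : 0 < n%:R :> R by rewrite ltr0n.
exists ((1 + n%:R^-1) `^ (r - 1)), ((n%:R + 1) `^ (r - 1) * C `^ r); split.
- have {1}-> : 1 = 1 `^ (r - 1) :> R by rewrite powR1.
  by rewrite powR_le// lerDl invr_ge0 ltW.
- by rewrite mulr_ge0// powR_ge0.
- have lamE : ((1 + n%:R^-1) `^ (r - 1)) ^+ n <= expR 1 `^ (r - 1) :> R.
    rewrite -powR_mulrn ?powR_ge0// -powRrM mulrC powRrM.
    rewrite powR_mulrn; last by rewrite addr_ge0// invr_ge0 ltW.
    apply: powR_le => //.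
    have -> : expR 1 = expR n%:R^-1 ^+ n :> R.
      by rewrite -expRM_natl divff// gt_eqF.
    by rewrite lerXn2r ?nnegrE ?expR_ge0 ?expR_ge1Dx// addr_ge0// invr_ge0 ltW.
  have KE : (n%:R + 1) `^ (r - 1) <= 2 `^ (r - 1) * n%:R `^ (r - 1) :> R.
    rewrite -powRM//; apply: powR_le => //.
    have : 1 <= n%:R :> R by rewrite ler1n.
    lra.
  have nr : n%:R `^ r = n%:R * n%:R `^ (r - 1) :> R by rewrite mulr_powRB1//; lra.
  rewrite nr; set L := _ ^+ n in lamE *; set E := expR 1 `^ _ in lamE *.
  apply: (@le_trans _ _ (n%:R * E * (2 `^ (r - 1) * n%:R `^ (r - 1) * C `^ r))).
    apply: ler_pM; rewrite ?mulr_ge0 ?powR_ge0 ?exprn_ge0 ?powR_ge0//.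
      by rewrite ler_wpM2l.
    by rewrite ler_wpM2r ?powR_ge0.
  by rewrite le_eqVlt; apply/orP; left; apply/eqP; ring.
- move=> a b; rewrite mulrC -ler_pdivrMr//; apply: le_trans (HC a b) _.
  have Cb : 0 <= C * b ^+ 2 by rewrite mulr_ge0 ?sqr_ge0// ltW.
  have n1 : 0 < n%:R + 1 :> R by rewrite addr_gt0.
  have t01 : 0 < (n%:R / (n%:R + 1) : R) < 1.
    by rewrite divr_gt0//= ltr_pdivrMr// mul1r ltrDl.
  apply: le_trans (powRD_weighted (ltW r1) t01 (sqr_ge0 a) Cb) _.
  rewrite powRM ?sqr_ge0 ?(ltW C0)// !sqr_powR_half mulrA.
  have -> : (n%:R / (n%:R + 1))^-1 = 1 + n%:R^-1 :> R.
    by field; rewrite !gt_eqF.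
  have -> : (1 - n%:R / (n%:R + 1))^-1 = n%:R + 1 :> R.
    rewrite (_ : 1 - _ = (n%:R + 1)^-1) ?invrK//.
    by field; rewrite !gt_eqF.
  by [].
Qed.

End two_point_constants.

(** * Means over the Hamming cube *)

Section cube_mean.
Context {R : realType}.
Implicit Types (g h : seq bool -> R) (s : seq bool).

(** Only words of length [n] contribute.  Splitting off the first letter is the
   step on which all inductions over the dimension rest. *)
Fixpoint cmean n g : R :=
  if n is n'.+1 then
    (cmean n' (fun s => g (true :: s)) + cmean n' (fun s => g (false :: s))) / 2
  else g [::].

Lemma ler_cmean n g h : (forall s, size s = n -> g s <= h s) ->
  cmean n g <= cmean n h.
Proof.
elim: n g h => [|n IH] g h gh /=; first exact: gh.
by rewrite ler_pM2r ?invr_gt0// lerD// IH// => s sn; apply: gh; rewrite /= sn.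
Qed.

Lemma eq_cmean n g h : (forall s, size s = n -> g s = h s) ->
  cmean n g = cmean n h.
Proof. by move=> gh; apply/eqP; rewrite eq_le !ler_cmean// => s /gh ->. Qed.

Lemma cmean_lin n (a b : R) g h :
  cmean n (fun s => a * g s + b * h s) = a * cmean n g + b * cmean n h.
Proof. by elim: n g h => [//|n IH] g h /=; rewrite !IH; field. Qed.

Lemma cmean_cst n (a : R) : cmean n (fun=> a) = a.
Proof. by elim: n => [//|n IH] /=; rewrite IH; field. Qed.

Lemma cmean_negb n g : cmean n (g \o map negb) = cmean n g.
Proof.
elim: n g => [//|n IH] g /=.
by rewrite -(IH (fun s => g (true :: s))) -(IH (fun s => g (false :: s))) addrC.
Qed.

Lemma cmean_witness n g : exists2 s, size s = n & g s <= cmean n g.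
Proof.
elim: n g => [|n IH] g /=; first by exists [::].
have [s1 s1n g1] := IH (fun s => g (true :: s)).
have [s2 s2n g2] := IH (fun s => g (false :: s)).
case: (leP (g (true :: s1)) (g (false :: s2))) => g12.
  by exists (true :: s1); rewrite /= ?s1n//; lra.
by exists (false :: s2); rewrite /= ?s2n//; lra.
Qed.

End cube_mean.

(** * A Poincare inequality from two-point smoothness *)

Section cube_poincare.
Context {R : realType} (V : lmodType R) (S : V -> Prop) (Phi : V -> R).
Hypothesis SD : forall u v, S u -> S v -> S (u + v).
Hypothesis SB : forall u v, S u -> S v -> S (u - v).
Hypothesis Shalf : forall u, S u -> S (2^-1 *: u).
Hypothesis Phi0 : Phi 0 = 0.
Hypothesis Phi_mid : forall u v, S u -> S v ->
  Phi (2^-1 *: (u + v)) <= (Phi u + Phi v) / 2.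

(** Induction on the dimension: [g] and [h] are the half sum and the half
   difference of the two facets.  The facets are [g + h] and [g - h], the edges
   of [g] are no longer than those of [f] by midpoint convexity, and [h] is half
   an edge, so the two-point inequality adds [K * b] and multiplies the previous
   bound by [lam].  The vector [m] obtained is the barycentre of the cube. *)
Lemma cube_poincare (lam K b : R) : 1 <= lam -> 0 <= K -> 0 <= b ->
  (forall u v, S u -> S v ->
    Phi (u + v) + Phi (u - v) <= 2 * (lam * Phi u + K * Phi v)) ->
  forall n (f : seq bool -> V), (forall s, S (f s)) ->
  (forall s1 s2, Phi (f (s1 ++ true :: s2) - f (s1 ++ false :: s2)) <= b) ->
  exists2 m, S m & cmean n (fun s => Phi (f s - m)) <= n%:R * lam ^+ n * K * b.
Proof.
move=> lam1 K0 b0 tp; have lam0 : 0 <= lam by lra.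
elim=> [|n IH] f Sf fb.
  by exists (f [::]) => //=; rewrite subrr Phi0 !mul0r.
pose g s := 2^-1 *: (f (true :: s) + f (false :: s)).
pose h s := 2^-1 *: (f (true :: s) - f (false :: s)).
have Sg s : S (g s) by apply/Shalf/SD.
have Sh s : S (h s) by apply/Shalf/SB.
have halfK (v : V) : 2^-1 *: (v + v) = v.
  by rewrite -mulr2n -(scaler_nat 2 v) scalerA mulVf ?scale1r// pnatr_eq0.
have gh1 s : f (true :: s) = g s + h s.
  by rewrite /g /h -scalerDr addrACA subrr addr0 halfK.
have gh2 s : f (false :: s) = g s - h s.
  by rewrite /g /h -scalerBr opprB (addrC (f (true :: s))) addrACA subrr addr0 halfK.
have hb s : Phi (h s) <= b.
  have S0 : S 0 by rewrite -(subrr (f [::])); exact: SB.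
  have := Phi_mid (SB (Sf (true :: s)) (Sf (false :: s))) S0.
  rewrite addr0 Phi0 addr0 => /le_trans; apply.
  by have := fb [::] s; rewrite /=; lra.
have [|m Sm mP] := IH g Sg.
  move=> s1 s2; rewrite /g -scalerBr opprD addrACA.
  have := Phi_mid (SB (Sf (true :: s1 ++ true :: s2)) (Sf (true :: s1 ++ false :: s2)))
    (SB (Sf (false :: s1 ++ true :: s2)) (Sf (false :: s1 ++ false :: s2))).
  move=> /le_trans; apply.
  by have := fb (true :: s1) s2; have := fb (false :: s1) s2; rewrite /=; lra.
exists m => //=.
rewrite mulrDl -(mulrC 2^-1) -(mulrC 2^-1) -cmean_lin.
apply: (@le_trans _ _
    (cmean n (fun s => lam * Phi (g s - m) + K * Phi (h s)))).
  apply: ler_cmean => s _; rewrite gh1 gh2 addrAC (addrAC (g s) (- h s)).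
  by have := tp _ _ (SB (Sg s) Sm) (Sh s); lra.
rewrite cmean_lin.
have hm : cmean n (fun s => Phi (h s)) <= b.
  by rewrite -[leRHS](cmean_cst n); exact: ler_cmean.
apply: le_trans (lerD (ler_wpM2l lam0 mP) (ler_wpM2l K0 hm)) _.
have Kb : K * b <= lam ^+ n.+1 * (K * b).
  by rewrite ler_peMl ?mulr_ge0// exprn_ege1.
apply: le_trans (lerD (lexx _) Kb) _.
by rewrite exprS -natr1 le_eqVlt; apply/orP; left; apply/eqP; ring.
Qed.

(** A vertex and its antipode are both compared with the centre [m]; since
   negation preserves the mean over the cube, some antipodal pair is no further
   apart than the average allows. *)
Lemma cube_antipodal (lam K b c : R) : 1 <= lam -> 0 <= K -> 0 <= b -> 0 <= c ->
  (forall u v, S u -> S v ->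
    Phi (u + v) + Phi (u - v) <= 2 * (lam * Phi u + K * Phi v)) ->
  (forall u v, S u -> S v -> Phi (u - v) <= c * (Phi u + Phi v)) ->
  forall n (f : seq bool -> V), (forall s, S (f s)) ->
  (forall s1 s2, Phi (f (s1 ++ true :: s2) - f (s1 ++ false :: s2)) <= b) ->
  exists2 s, size s = n &
    Phi (f s - f (map negb s)) <= 2 * c * (n%:R * lam ^+ n * K * b).
Proof.
move=> lam1 K0 b0 c0 tp qt n f Sf fb.
have [m Sm mP] := cube_poincare lam1 K0 b0 tp n Sf fb.
pose d s := Phi (f s - m).
have [s sn sP] := cmean_witness n (fun s => c * d s + c * (d \o map negb) s).
exists s => //; move: sP; rewrite cmean_lin cmean_negb => sP.
have -> : f s - f (map negb s) = (f s - m) - (f (map negb s) - m).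
  by rewrite opprB addrA subrK.
apply: le_trans (qt _ _ (SB (Sf _) Sm) (SB (Sf _) Sm)) _.
rewrite mulrDr; apply: le_trans sP _.
by have := ler_wpM2l c0 mP; rewrite /d; lra.
Qed.

End cube_poincare.

(** * Short diagonals in L_q *)

Section antipodal_bound.
Context {R : realType}.

(** The exponent [t] is an Enflo type of [M] in a weak form: edges of length at
   most [b] of an [n]-cube in [M] force one of its diagonals to be no longer
   than a constant multiple of [b * n ^ (1 / t)].  The cube [F] is indexed by
   words of every length so that its edges need no bookkeeping of lengths. *)
Definition antipodal_bound (M : metricType R) (t : R) := exists2 C : R, 0 < C &
  forall n : nat, (0 < n)%N -> forall (b : R) (F : seq bool -> M), 0 <= b ->
  (forall s1 s2, mdist (F (s1 ++ true :: s2)) (F (s1 ++ false :: s2)) <= b) ->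
  exists2 s, size s = n &
    mdist (F s) (F (map negb s)) <= C * b * n%:R `^ t^-1.

(** A diagonal is a path of [n] edges, obtained by negating one letter at a
   time. *)
Lemma antipodal_bound1 (M : metricType R) : antipodal_bound M 1.
Proof.
exists 1 => // n n0 b F b0 Fb; exists (nseq n true); first by rewrite size_nseq.
rewrite mul1r invr1 powRr1// mulrC.
have path s1 s : mdist (F (s1 ++ s)) (F (s1 ++ map negb s)) <= (size s)%:R * b.
  elim: s s1 => [|c s IH] s1; first by rewrite mdistxx mul0r.
  apply: le_trans (metric_triangle _ (F (s1 ++ ~~ c :: s)) _) _.
  rewrite [size _]/= -natr1 mulrDl mul1r addrC [map _ _]/=.
  have := IH (rcons s1 (~~ c)); rewrite !cat_rcons => /lerD; apply.
  by case: c => //=; rewrite metric_sym.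
by have := path [::] (nseq n true); rewrite size_nseq.
Qed.

End antipodal_bound.

Section Lq_antipodal_bound.
Context d (T : measurableType d) {R : realType}.
Context (mu : {measure set T -> \bar R}) (q : R) (q_ge1 : 1 <= q).

Let q_gt0 : 0 < q. Proof. exact: lt_le_trans q_ge1. Qed.

Definition in_Lq (u : T -> R) :=
  measurable_fun setT u /\ (\int[mu]_t (`|u t| `^ q)%:E < +oo)%E.

Definition mass (u : T -> R) : R := fine (\int[mu]_t (`|u t| `^ q)%:E)%E.

Lemma measurable_mass (u : T -> R) : measurable_fun setT u ->
  measurable_fun setT (fun t => (`|u t| `^ q)%:E).
Proof.
move=> mu'; apply/measurable_EFinP.
apply: (@measurableT_comp _ _ _ _ _ _ (@powR R ^~ q)) => //.
exact: measurableT_comp.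
Qed.

Lemma in_LqD u v : in_Lq u -> in_Lq v -> in_Lq (u + v).
Proof.
move=> [mu' iu] [mv iv]; split; first exact: measurable_funD.
exact: (massD_lty q_gt0 mu' mv iu iv).
Qed.

Lemma in_LqB u v : in_Lq u -> in_Lq v -> in_Lq (u - v).
Proof.
move=> [mu' iu] [mv iv]; split; first exact: measurable_funB.
exact: (massB_lty q_gt0 mu' mv iu iv).
Qed.

Lemma in_Lq_half u : in_Lq u -> in_Lq (2^-1 *: u).
Proof.
move=> [mu' iu]; have mu2 : measurable_fun setT (2^-1 *: u).
  by apply: measurable_funM.
split; [exact: mu2|apply: le_lt_trans iu; apply: ge0_le_integral].
- exact: measurableT.
- by move=> t _; rewrite lee_fin powR_ge0.
- exact: measurable_mass mu2.
- exact: measurable_mass mu'.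
- move=> t _; rewrite lee_fin powR_le ?(ltW q_gt0)//= normrM ger0_norm ?invr_ge0//.
  by have := normr_ge0 (u t); lra.
Qed.

Lemma mass_ge0 u : 0 <= mass u.
Proof.
by apply: fine_ge0; apply: integral_ge0 => t _; rewrite lee_fin powR_ge0.
Qed.

Lemma mass0 : mass 0 = 0.
Proof.
rewrite /mass; under eq_integral do rewrite normr0 powR0 ?gt_eqF//.
by rewrite integral0.
Qed.

Lemma EFin_mass u : in_Lq u -> (mass u)%:E = (\int[mu]_t (`|u t| `^ q)%:E)%E.
Proof.
move=> [_ iu]; rewrite fineK// ge0_fin_numE//.
by apply: integral_ge0 => t _; rewrite lee_fin powR_ge0.
Qed.

(** Pointwise inequalities between [q]-th powers pass to the masses; this shape
   covers the two-point, the midpoint and the quasi-triangle inequality. *)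
Lemma mass_le (u1 u2 v1 v2 : T -> R) (a b : R) : in_Lq u1 -> in_Lq u2 ->
  in_Lq v1 -> in_Lq v2 -> 0 <= a -> 0 <= b ->
  (forall t, `|u1 t| `^ q + `|u2 t| `^ q <= a * `|v1 t| `^ q + b * `|v2 t| `^ q) ->
  mass u1 + mass u2 <= a * mass v1 + b * mass v2.
Proof.
move=> u1q u2q v1q v2q a0 b0 uv.
have mm w : in_Lq w -> measurable_fun setT (fun t => (`|w t| `^ q)%:E).
  by move=> [mw _]; exact: measurable_mass.
have m0 (w : T -> R) t : setT t -> (0 <= (`|w t| `^ q)%:E)%E.
  by rewrite lee_fin powR_ge0.
have mZ (c : R) w : in_Lq w ->
    measurable_fun setT (fun t => (c%:E * (`|w t| `^ q)%:E)%E).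
  by move=> wq; apply: measurable_funeM; exact: mm.
have mZ0 (c : R) (w : T -> R) : 0 <= c -> forall t, setT t ->
    (0 <= c%:E * (`|w t| `^ q)%:E)%E.
  by move=> c0 t _; rewrite mule_ge0 ?lee_fin// powR_ge0.
have intZ (c : R) w : 0 <= c -> in_Lq w ->
    (c * mass w)%:E = (\int[mu]_t (c%:E * (`|w t| `^ q)%:E))%E.
  move=> c0 wq; rewrite EFinM EFin_mass//.
  by rewrite (ge0_integralZl_EFin _ measurableT (m0 w) (mm _ wq) c0).
have intD (c e : R) w z : 0 <= c -> 0 <= e -> in_Lq w -> in_Lq z ->
    (c * mass w + e * mass z)%:E =
    (\int[mu]_t (c%:E * (`|w t| `^ q)%:E + e%:E * (`|z t| `^ q)%:E))%E.
  move=> c0 e0 wq zq; rewrite EFinD (intZ _ _ c0 wq) (intZ _ _ e0 zq).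
  by rewrite (ge0_integralD _ measurableT (mZ0 c w c0) (mZ c w wq)
    (mZ0 e z e0) (mZ e z zq)).
have -> : mass u1 + mass u2 = 1 * mass u1 + 1 * mass u2 by rewrite !mul1r.
rewrite -lee_fin (intD _ _ _ _ ler01 ler01 u1q u2q) (intD _ _ _ _ a0 b0 v1q v2q).
apply: ge0_le_integral; first exact: measurableT.
- by move=> t tT; apply: adde_ge0; apply: mZ0.
- by apply: emeasurable_funD; exact: mZ.
- by apply: emeasurable_funD; exact: mZ.
- by move=> t _; rewrite -!EFinM -!EFinD lee_fin !mul1r.
Qed.

#[local] Opaque mass in_Lq.

(** The pointwise inequalities feed [cube_antipodal] with [Phi] the mass; the
   quasi-triangle inequality holds with constant [2 ^ q] because [|x - y|] is at
   most twice the larger of [|x|] and [|y|]. *)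
Lemma Lq_antipodal : exists2 C : R, 0 < C &
  forall n : nat, (0 < n)%N -> forall (b : R) (f : seq bool -> T -> R),
  0 <= b -> (forall s, in_Lq (f s)) ->
  (forall s1 s2, mass (f (s1 ++ true :: s2) - f (s1 ++ false :: s2)) <= b) ->
  exists2 s, size s = n &
    mass (f s - f (map negb s)) <= C * b * n%:R `^ (q / tau q).
Proof.
have [C C0 HC] := two_point_tau q_ge1.
exists (2 * 2 `^ q * C) => [|n n0 b f b0 fq fb].
  by rewrite !mulr_gt0// powR_gt0.
have in0 : in_Lq 0.
  by rewrite -(subrr (f [::])); apply: in_LqB.
have z0 : `|0 : R| `^ q = 0 :> R by rewrite normr0 powR0// gt_eqF.
have [lam [K [lam1 K0 lamK tp]]] := HC n n0.
have [|u v uq vq|u v uq vq|u v uq vq|s sn sP] :=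
  @cube_antipodal R (T -> R) in_Lq mass in_LqD in_LqB in_Lq_half _ _
    lam K b (2 `^ q) lam1 K0 b0 (powR_ge0 _ _) _ _ n f fq fb.
- exact: mass0.
- have := @mass_le (2^-1 *: (u + v)) 0 u v 2^-1 2^-1.
  rewrite mass0 addr0 => /(_ (in_Lq_half (in_LqD uq vq)) in0 uq vq) H.
  rewrite mulrDl -!(mulrC 2^-1); apply: H => //; rewrite ?invr_ge0// => t /=.
  rewrite z0 addr0 -mulrDr mulrC.
  apply: le_trans (powR_midconvex q_ge1 (normr_ge0 (u t)) (normr_ge0 (v t))).
  apply: powR_le => //; first exact: ltW.
  by rewrite normrM ger0_norm ?invr_ge0// mulrC ler_pM2r ?invr_gt0// ler_normD.
- rewrite mulrDr !mulrA; apply: mass_le.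
  + exact: in_LqD.
  + exact: in_LqB.
  + exact: uq.
  + exact: vq.
  + by rewrite mulr_ge0//; lra.
  + by rewrite mulr_ge0.
  + by move=> t /=; apply: le_trans (tp _ _) _; rewrite mulrDr !mulrA.
- have := @mass_le (u - v) 0 u v (2 `^ q) (2 `^ q).
  rewrite mass0 addr0 mulrDr => /(_ (in_LqB uq vq) in0 uq vq); apply => //.
  move=> t /=; rewrite z0 addr0 -!powRM//.
  have [uv|uv] := leP `|u t| `|v t|.
  + rewrite ler_wpDl ?powR_ge0// powR_le ?(ltW q_gt0)//.
    by apply: le_trans (ler_normB _ _) _; lra.
  + rewrite ler_wpDr ?powR_ge0// powR_le ?(ltW q_gt0)//.
    by apply: le_trans (ler_normB _ _) _; lra.
- exists s => //; apply: le_trans sP _.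
  have := ler_wpM2l (powR_ge0 2 q) (ler_wpM2r b0 lamK).
  by lra.
Qed.

End Lq_antipodal_bound.

Section antipodal_Lp.
Context {R : realType}.

(** For [q > 1] the distance is the [q]-th root of the mass of the difference,
   so the bound of order [n ^ (q / tau q)] on masses becomes one of order
   [n ^ (1 / tau q)]; for [q <= 1] the distance is the mass itself and
   [tau q = 1] only asks for the triangle inequality. *)
Lemma antipodal_bound_Lq d (T : measurableType d)
    (mu : {measure set T -> \bar R}) (q : R) (M : metricType R)
    (coe : M -> T -> R) : 0 < q ->
  (forall x, in_Lq mu q (coe x)) ->
  (forall x y, mdist x y =
    proot q (\int[mu]_t (`|(coe x - coe y) t| `^ q)%:E)%E) ->
  antipodal_bound M (tau q).
Proof.
move=> q0 coeq distE; have [q1|q1] := leP q 1.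
  by rewrite tau_le1//; exact: antipodal_bound1.
have distE' x y : mdist x y = mass mu q (coe x - coe y) `^ q^-1.
  by rewrite distE /proot leNgt q1.
have [C C0 HC] := Lq_antipodal mu (ltW q1).
exists (C `^ q^-1) => [|n n0 b F b0 Fb]; first exact: powR_gt0.
have [s|s1 s2|s sn sP] :=
    HC n n0 (b `^ q) (fun s => coe (F s)) (powR_ge0 _ _) _ _.
- exact: coeq.
- have := powR_le (ltW q0) (mdist_ge0 _ _) (Fb s1 s2).
  by rewrite distE' -powRrM mulVf ?gt_eqF// powRr1// mass_ge0.
exists s => //; rewrite distE'.
have qi0 : 0 <= q^-1 by rewrite invr_ge0 ltW.
apply: le_trans (powR_le qi0 (mass_ge0 _ _ _) sP) _.
rewrite !powRM ?mulr_ge0 ?powR_ge0 ?(ltW C0)// -!powRrM divff ?gt_eqF//.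
by rewrite powRr1// (mulrAC q) divff ?gt_eqF// mul1r.
Qed.

Lemma ellp_antipodal_bound (q : R) (q0 : 0 < q) :
  antipodal_bound (ellp q0) (tau q).
Proof.
have E (u : nat -> R) : (\sum_(n <oo) (`|u n| `^ q)%:E)%E =
    (\int[counting]_n (`|u n| `^ q)%:E)%E.
  by rewrite ge0_integral_count// => n; rewrite lee_fin powR_ge0.
apply: (@antipodal_bound_Lq _ nat counting q (ellp q0) (@ellp_seq R q q0)) => //.
  by move=> x; split; [by []|rewrite -E; exact: ellp_summable].
by move=> x y; rewrite ellp_mdistE /ellp_dist -E.
Qed.

Lemma Lp_measurable (q : R) (q0 : 0 < q) (x : Lp q0) :
  measurable_fun setT (x : measurableTypeR R -> R).
Proof. exact: (measurable_funPT (repr (Lp_class x))). Qed.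

Lemma Lp_antipodal_bound (q : R) (q0 : 0 < q) : antipodal_bound (Lp q0) (tau q).
Proof.
apply: (@antipodal_bound_Lq _ (measurableTypeR R) (lebesgue01 R) q (Lp q0)
  (fun x : Lp q0 => x : measurableTypeR R -> R)) => //.
move=> x; split; [exact: Lp_measurable|exact: Lp_integrable].
Qed.

End antipodal_Lp.

(** * Stretched cubes in spaces containing all finite-dimensional l_p *)

Section stretched_cubes.
Context {R : realType}.
Implicit Types p : R.

(** Cubes with short edges all of whose diagonals are as long as an Enflo type
   [t] could allow. *)
Definition stretched_cubes (M : metricType R) (t : R) :=
  forall n : nat, (0 < n)%N -> exists F : seq bool -> M,
  (forall s1 s2, mdist (F (s1 ++ true :: s2)) (F (s1 ++ false :: s2)) <= 1) /\
  (forall s, size s = n -> n%:R `^ t^-1 <= mdist (F s) (F (map negb s))).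

Definition contains_lpN (M : metricType R) p := forall N : nat,
  exists J : (nat -> R) -> M, forall u v,
    mdist (J u) (J v) = proot p (\sum_(i < N) `|u i - v i| `^ p)%:E.

Definition bit (s : seq bool) (i : nat) : R := (nth false s i)%:R.

Lemma bit_edge s1 s2 i :
  bit (s1 ++ true :: s2) i - bit (s1 ++ false :: s2) i = (i == size s1)%:R.
Proof.
rewrite /bit !nth_cat; case: ltngtP => [i1|i1|->].
- by rewrite subrr.
- by rewrite -(subnSK i1) /= subrr.
- by rewrite subnn /= subr0.
Qed.

Lemma bit_diagonal s i : (i < size s)%N ->
  bit s i - bit (map negb s) i = 1 \/ bit s i - bit (map negb s) i = -1.
Proof.
move=> i1; rewrite /bit (nth_map false)//; case: (nth false s i) => /=.
  by left; rewrite subr0.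
by right; rewrite sub0r.
Qed.

Lemma le_proot p (x y : R) : 0 < p -> 0 <= x -> x <= y ->
  proot p x%:E <= proot p y%:E.
Proof.
move=> p0 x0 xy; rewrite /proot /=; case: ifP => // _.
by rewrite powR_le// invr_ge0 ltW.
Qed.

Lemma proot1 p : proot p 1%:E = 1 :> R.
Proof. by rewrite /proot /=; case: ifP; rewrite ?powR1. Qed.

(** The vertices are 0/1 vectors: two neighbours differ by a basis vector, and
   antipodes differ by [1] in each of the [n] coordinates. *)
Lemma stretched_cubes_le2 (M : metricType R) p : 0 < p -> p <= 2 ->
  contains_lpN M p -> stretched_cubes M (tau p).
Proof.
move=> p0 p2 lpM n n0; have [J JE] := lpM n.
have z0 : `|0 : R| `^ p = 0 by rewrite normr0 powR0// gt_eqF.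
exists (fun s => J (bit s)); split => [s1 s2|s sn].
  rewrite JE -[leRHS](proot1 p) le_proot//.
    by apply: sumr_ge0 => i _; exact: powR_ge0.
  under eq_bigr do rewrite bit_edge.
  have [ns|sn] := leqP n (size s1).
    rewrite big1// => i _; case: eqVneq => [is1|_]; last exact: z0.
    by move: (ltn_ord i); rewrite is1 ltnNge ns.
  rewrite (bigD1 (Ordinal sn))//= eqxx normr1 powR1 big1 ?addr0// => i.
  by rewrite -val_eqE /= => /negPf ->; exact: z0.
have -> : mdist (J (bit s)) (J (bit (map negb s))) = proot p n%:R%:E.
  rewrite JE; congr (proot p _%:E).
  rewrite -[n in RHS]card_ord -sumr_const; apply: eq_bigr => i _.
  have [|->|->] := @bit_diagonal s i; first by rewrite sn.
    by rewrite normr1 powR1.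
  by rewrite normrN normr1 powR1.
rewrite /proot /tau /=; case: ifPn => p1; last by rewrite p2.
by rewrite invr1 powRr1.
Qed.

Definition sgn_bit (x : seq bool) (i : nat) : R :=
  if nth false x i then 1 else -1.

(** Orthonormality of the Rademacher functions. *)
Lemma cmean_rademacher_sqr n (e : nat -> R) :
  cmean n (fun x => (\sum_(i < n) e i * sgn_bit x i) ^+ 2) =
  \sum_(i < n) e i ^+ 2.
Proof.
elim: n e => [|n IH] e; first by rewrite /= !big_ord0 expr0n.
rewrite big_ord_recl /= -(IH (fun i => e i.+1)).
set Q := fun x => (\sum_(i < n) e i.+1 * sgn_bit x i) ^+ 2.
pose L x := \sum_(i < n) e i.+1 * sgn_bit x i.
have step (c : bool) x : \sum_(i < n.+1) e i * sgn_bit (c :: x) i =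
    (if c then e 0%N else - e 0%N) + L x.
  rewrite big_ord_recl /=; congr (_ + _).
  by rewrite /sgn_bit /=; case: c; rewrite ?mulr1 ?mulrN1.
rewrite mulrDl -!(mulrC 2^-1) -cmean_lin.
rewrite -[X in X + cmean _ _](cmean_cst n) -[RHS]mul1r mulrDr -cmean_lin.
apply: eq_cmean => x _; rewrite !step /Q -/(L x).
by rewrite -[L]/L; field.
Qed.

(** Jensen inequality for the mean over the cube. *)
Lemma powR_cmean n (r : R) (g : seq bool -> R) : 1 <= r ->
  (forall x, 0 <= g x) -> cmean n g `^ r <= cmean n (fun x => g x `^ r).
Proof.
move=> r1; elim: n g => [|n IH] g g0 //=.
have cm0 (h : seq bool -> R) : (forall x, 0 <= h x) -> 0 <= cmean n h.
  by move=> h0; rewrite -(cmean_cst n 0); exact: ler_cmean.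
apply: le_trans (powR_midconvex r1 (cm0 _ (fun x => g0 (true :: x)))
  (cm0 _ (fun x => g0 (false :: x)))) _.
by rewrite ler_pM2r ?invr_gt0// lerD// IH.
Qed.

Fixpoint words n : seq (seq bool) :=
  if n is n'.+1 then map (cons true) (words n') ++ map (cons false) (words n')
  else [:: [::]].

Lemma size_words n : size (words n) = (2 ^ n)%N.
Proof. by elim: n => //= n IH; rewrite size_cat !size_map IH addnn expnS mul2n. Qed.

Lemma cmean_words n (g : seq bool -> R) :
  cmean n g = (2 ^+ n)^-1 * \sum_(x <- words n) g x.
Proof.
elim: n g => [|n IH] g /=; first by rewrite big_seq1 expr0 invr1 mul1r.
rewrite !IH big_cat !big_map -mulrDr exprS invfM mulrC mulrA; congr (_ * _).
Qed.

(** Up to the scaling factor [c], the space [L_p] over the uniform measure of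
   the cube is [l_p] of dimension [2 ^ n]. *)
Lemma contains_cmean (M : metricType R) p n : 0 < p -> contains_lpN M p ->
  exists J : (seq bool -> R) -> M, forall u v,
    mdist (J u) (J v) = proot p (cmean n (fun x => `|u x - v x| `^ p))%:E.
Proof.
move=> p0 /(_ (2 ^ n)%N) [J JE].
pose c : R := ((2 ^+ n)^-1) `^ p^-1.
have c0 : 0 <= c by exact: powR_ge0.
have cp : c `^ p = (2 ^+ n)^-1.
  by rewrite -powRrM mulVf ?gt_eqF// powRr1// invr_ge0 exprn_ge0.
exists (fun u => J (fun i => c * u (nth [::] (words n) i))) => u v.
rewrite JE cmean_words (big_nth [::]) size_words big_mkord mulr_sumr.
congr (proot p _%:E); apply: eq_bigr => i _.
by rewrite -mulrBr normrM powRM// (ger0_norm c0) cp.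
Qed.

(** For [p > 2] the diagonals of the cube of 0/1 vectors have length
   [n ^ (1 / p)] only, which is too short.  Replacing the basis vectors by
   Rademacher functions keeps the edges at length [1], and a diagonal is a signed
   sum of [n] orthonormal functions: its [2]-norm is [n ^ (1 / 2)], and its
   [p]-norm is at least that by Jensen. *)
Lemma stretched_cubes_gt2 (M : metricType R) p : 2 < p ->
  contains_lpN M p -> stretched_cubes M (tau p).
Proof.
move=> p2 lpM n n0; have p0 : 0 < p by lra.
have z0 : `|0 : R| `^ p = 0 by rewrite normr0 powR0// gt_eqF.
have [J JE] := contains_cmean n p0 lpM.
pose rad s x : R := \sum_(i < n) bit s i * sgn_bit x i.
have radB s t x : rad s x - rad t x = \sum_(i < n) (bit s i - bit t i) * sgn_bit x i.
  by rewrite /rad -sumrB; apply: eq_bigr => i _; rewrite mulrBl.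
exists (fun s => J (rad s)); split => [s1 s2|s sn].
  rewrite JE -[leRHS](proot1 p) le_proot//.
    rewrite -(cmean_cst n 0); apply: ler_cmean => x _; exact: powR_ge0.
  rewrite -[leRHS](cmean_cst n); apply: ler_cmean => x _; rewrite radB.
  under eq_bigr do rewrite bit_edge.
  have [ns|sn] := leqP n (size s1).
    rewrite big1 ?z0// => i _; case: eqVneq => [is1|_]; last by rewrite mul0r.
    by move: (ltn_ord i); rewrite is1 ltnNge ns.
  rewrite (bigD1 (Ordinal sn))//= eqxx mul1r big1 ?addr0 => [|i].
    by rewrite /sgn_bit; case: ifP; rewrite ?normrN normr1 powR1.
  by rewrite -val_eqE /= => /negPf ->; rewrite mul0r.
rewrite JE tau_ge2 ?(ltW p2)//.
have p1 : (p <= 1) = false by apply/negbTE; rewrite -ltNge; lra.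
rewrite /proot p1 /=.
have h : (n%:R : R) `^ (p / 2) <= cmean n (fun x => `|rad s x - rad (map negb s) x| `^ p).
  have := @powR_cmean n (p / 2) (fun x => (rad s x - rad (map negb s) x) ^+ 2).
  have -> : cmean n (fun x => (rad s x - rad (map negb s) x) ^+ 2) = n%:R.
    transitivity (\sum_(i < n) (bit s i - bit (map negb s) i) ^+ 2).
      rewrite -(cmean_rademacher_sqr n (fun i => bit s i - bit (map negb s) i)).
      by apply: eq_cmean => x _; rewrite radB.
    rewrite -[n in RHS]card_ord -sumr_const; apply: eq_bigr => i _.
    have [|->|->] := @bit_diagonal s i; first by rewrite sn.
      by rewrite expr1n.
    by rewrite sqrrN expr1n.
  move=> /(_ _ (fun x => sqr_ge0 _)) => /(_ ltac:(lra)).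
  by move=> /le_trans; apply; apply: ler_cmean => x _; rewrite sqr_powR_half.
apply: (le_trans _ (powR_le _ (powR_ge0 _ _) h)); last by rewrite invr_ge0 ltW.
by rewrite -powRrM mulrAC divff ?gt_eqF// mul1r.
Qed.

Lemma stretched_cubes_lpN (M : metricType R) p : 0 < p ->
  contains_lpN M p -> stretched_cubes M (tau p).
Proof.
move=> p0; have [p2|p2] := leP p 2; first exact: stretched_cubes_le2.
exact: stretched_cubes_gt2.
Qed.

End stretched_cubes.

(** * Finite-dimensional l_p inside ell_p and L_p *)

Section finite_dimensional_subspaces.
Context {R : realType}.
Implicit Types p : R.

Lemma nneseries_finite p (N : nat) (v : nat -> R) : 0 < p ->
  (forall i, (N <= i)%N -> v i = 0) ->
  (\sum_(n <oo) (`|v n| `^ p)%:E)%E = (\sum_(i < N) `|v i| `^ p)%:E.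
Proof.
move=> p0 v0; rewrite (nneseries_split 0 N); last first.
  by move=> k _; rewrite lee_fin powR_ge0.
rewrite add0n eseries0 ?adde0 ?sumEFin ?big_mkord// => k Nk _.
by rewrite v0// normr0 powR0// gt_eqF.
Qed.

Lemma ellp_contains_lpN p (p0 : 0 < p) : contains_lpN (ellp p0) p.
Proof.
move=> N; pose cut (u : nat -> R) i := if (i < N)%N then u i else 0.
have cut0 u i : (N <= i)%N -> cut u i = 0 by rewrite /cut ltnNge => ->.
have cut_fin u : (\sum_(n <oo) (`|cut u n| `^ p)%:E < +oo)%E.
  by rewrite (nneseries_finite p0 (cut0 u)) ltry.
exists (fun u => Ellp p0 (cut_fin u)) => u v.
have uv0 i : (N <= i)%N -> cut u i - cut v i = 0.
  by move=> Ni; rewrite !cut0// subrr.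
rewrite ellp_mdistE /ellp_dist /= (nneseries_finite p0 uv0).
by congr (proot p _%:E); apply: eq_bigr => i _; rewrite /cut ltn_ord.
Qed.

Lemma Lp_of_fun p (p0 : 0 < p) (f : measurableTypeR R -> measurableTypeR R) :
  in_Lq (lebesgue01 R) p f ->
  exists x : Lp p0, (x : _ -> _) = f %[ae lebesgue01 R].
Proof.
move=> [mf intf].
pose c : {mfun_ (lebesgue01 R), measurableTypeR R >-> measurableTypeR R} :=
  (\pi_({mfun_ (lebesgue01 R), measurableTypeR R >-> measurableTypeR R})
    (mfun_Sub (mem_set mf)))%qT.
have cE : (c : _ -> _) = f %[ae lebesgue01 R].
  have /eqP := reprK c; rewrite /c eqmodE => /asboolP; exact.
have mc : measurable_fun setT (c : measurableTypeR R -> measurableTypeR R).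
  exact: (measurable_funPT (repr c)).
suff cfin : (\int[lebesgue01 R]_t (`|(c t : R)| `^ p)%:E < +oo)%E.
  by exists (MkLp p0 cfin).
rewrite (@ge0_ae_eq_integral _ _ _ (lebesgue01 R) setT _
  (fun t => (`|f t| `^ p)%:E)).
- exact: intf.
- exact: measurableT.
- by apply: measurable_mass; exact: mc.
- by apply: measurable_mass; exact: mf.
- by move=> t _; rewrite lee_fin powR_ge0.
- by move=> t _; rewrite lee_fin powR_ge0.
- by apply: filterS cE => t /(_ I) cf _; rewrite cf.
Qed.

(** At each point at most one of the disjoint sets contributes to the sum. *)
Lemma sum_indic_powR (T : Type) p (A : nat -> set T) N (w : nat -> R) t :
  0 < p -> trivIset setT A ->
  `|\sum_(i < N) w i * \1_(A i) t| `^ p =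
  \sum_(i < N) `|w i| `^ p * \1_(A i) t.
Proof.
move=> p0 tA; have [[j Aj]|nA] := pselect (exists j : 'I_N, A j t).
  have off (i : 'I_N) : i != j -> \1_(A i) t = 0 :> R.
    move=> ij; rewrite indicE memNset// => Ai; move/eqP: ij; apply.
    apply: val_inj; apply: (tA i j I I); exists t; split=> //.
  rewrite (bigD1 j)//= [in RHS](bigD1 j)//= !big1 ?addr0.
  - by rewrite indicE mem_set// !mulr1.
  - by move=> i /off ->; rewrite mulr0.
  - by move=> i /off ->; rewrite mulr0.
have off (i : 'I_N) : \1_(A i) t = 0 :> R.
  by rewrite indicE memNset// => Ai; apply: nA; exists i.
rewrite !big1 ?normr0 ?powR0// ?gt_eqF// => i _; rewrite off mulr0//.
Qed.

Lemma measurable_sum_indic d (T : measurableType d) (A : nat -> set T) N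
    (w : nat -> R) : (forall i, measurable (A i)) ->
  measurable_fun setT (fun t => \sum_(i < N) w i * \1_(A i) t).
Proof.
move=> mA; apply: measurable_sum => i; apply: measurable_funM => //.
Qed.

Lemma sum_indic_integral d (T : measurableType d)
    (mu : {measure set T -> \bar R}) p (A : nat -> set T) N (w : nat -> R)
    (m : R) : 0 < p -> trivIset setT A -> (forall i, measurable (A i)) ->
  (forall i, (i < N)%N -> mu (A i) = m%:E) ->
  (\int[mu]_t (`|\sum_(i < N) w i * \1_(A i) t| `^ p)%:E)%E =
  (m * \sum_(i < N) `|w i| `^ p)%:E.
Proof.
move=> p0 tA mA muA.
under eq_integral do rewrite sum_indic_powR// -sumEFin.
have mind (i : 'I_N) : measurable_fun setT (fun t => (\1_(A i) t : R)%:E).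
  by apply/measurable_EFinP; exact: measurable_indic.
have E (i : 'I_N) : (\int[mu]_t (`|w i| `^ p * \1_(A i) t)%:E)%E =
    (m * `|w i| `^ p)%:E.
  under eq_integral do rewrite EFinM.
  rewrite (ge0_integralZl_EFin _ measurableT _ (mind i) (powR_ge0 _ _)).
    by rewrite integral_indic// setIT muA// -EFinM mulrC.
  by move=> t _; rewrite lee_fin.
rewrite ge0_integral_sum//.
- by rewrite mulr_sumr -sumEFin; apply: eq_bigr => i _; exact: E.
- move=> i; apply/measurable_EFinP; apply: measurable_funM => //.
Qed.

(** The basis vectors are normalized indicators of disjoint subintervals of
   equal length. *)
Lemma Lp_contains_lpN p (p0 : 0 < p) : contains_lpN (Lp p0) p.
Proof.
(* Cutting into [N.+1] pieces and using [N] of them keeps the length positive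
   when [N = 0]. *)
move=> N; pose k : R := N.+1%:R; have k0 : 0 < k by rewrite ltr0n.
pose A (i : nat) : set (measurableTypeR R) := `]i%:R / k, i.+1%:R / k]%classic.
have mA i : measurable (A i) by exact: measurable_itv.
have tA : trivIset setT A.
  move=> i j _ _ [t []]; rewrite /A /= !in_itv /= !ltr_pdivrMr// !ler_pdivlMr//.
  move=> /andP[i1 i2] /andP[j1 j2].
  have := lt_le_trans i1 j2; have := lt_le_trans j1 i2.
  by rewrite !ltr_nat !ltnS => ji ij; apply/eqP; rewrite eqn_leq ij ji.
have muA i : (i < N)%N -> lebesgue01 R (A i) = (k^-1)%:E.
  move=> iN; transitivity (@lebesgue_measure R (A i)).
    congr (lebesgue_measure _).
    apply/setIidl => t; rewrite /A /= !in_itv /= => /andP[t1 t2]; apply/andP; split.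
      by apply: ltW; apply: le_lt_trans t1; rewrite divr_ge0// ltW.
    by apply: le_trans t2 _; rewrite ler_pdivrMr// mul1r ler_nat ltnS ltnW.
  rewrite /A lebesgue_measure_itv /= lte_fin ltr_pM2r ?invr_gt0// ltr_nat leqnn.
  by rewrite -EFinB -mulrBl -natr1 addrAC subrr add0r mul1r.
pose c := k `^ p^-1.
have cp : c `^ p = k by rewrite -powRrM mulVf ?gt_eqF// powRr1// ltW.
pose step (w : nat -> R) (t : measurableTypeR R) : measurableTypeR R :=
  \sum_(i < N) w i * \1_(A i) t.
have mstep w : measurable_fun setT (step w).
  exact: measurable_sum_indic.
have stepLp w : in_Lq (lebesgue01 R) p (step w).
  split; first exact: mstep.
  by rewrite (sum_indic_integral w p0 tA mA muA) ltry.
have [J JE] := choice (fun u : nat -> R =>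
  Lp_of_fun p0 (stepLp (fun i => c * u i))).
exists J => u v; rewrite Lp_mdistE /Lp_dist.
have -> : (\sum_(i < N) `|u i - v i| `^ p)%:E =
    (\int[lebesgue01 R]_t (`|step (fun i => c * (u i - v i)) t| `^ p)%:E)%E.
  rewrite (sum_indic_integral _ p0 tA mA muA) mulr_sumr; congr _%:E.
  apply: eq_bigr => i _; rewrite normrM powRM// (ger0_norm (powR_ge0 _ _)) cp.
  by rewrite mulrA mulVf ?mul1r// gt_eqF.
congr (proot p _); apply: ge0_ae_eq_integral.
- exact: measurableT.
- apply: (measurable_mass p (u := fun t => (J u t : R) - J v t)).
  by apply: measurable_funB; exact: Lp_measurable.
- by apply: measurable_mass; exact: mstep.
- by move=> t _; rewrite lee_fin powR_ge0.
- by move=> t _; rewrite lee_fin powR_ge0.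
- apply: filterS2 (JE u) (JE v) => t /(_ I) -> /(_ I) -> _.
  rewrite /step -sumrB; congr (`|_| `^ p)%:E; apply: eq_bigr => i _.
  by rewrite -mulrBl -mulrBr.
Qed.

End finite_dimensional_subspaces.

(** * Comparing the two estimates *)

Section obstruction.
Context {R : realType}.

Lemma powR_unbounded (e C : R) : 0 < e ->
  exists2 n : nat, (0 < n)%N & C < n%:R `^ e.
Proof.
move=> e0; pose n := (Num.truncn (`|C| `^ e^-1)).+1.
exists n => //; apply: le_lt_trans (ler_norm C) _.
have Cn : `|C| `^ e^-1 < n%:R by exact: truncnS_gt.
have -> : `|C| = (`|C| `^ e^-1) `^ e by rewrite -powRrM mulVf ?gt_eqF// powRr1.
by apply: gt0_ltr_powR => //; rewrite nnegrE ?powR_ge0.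
Qed.

(** A stretched cube of dimension [n] is mapped to a cube whose edges are
   bounded and whose diagonals have length at least a multiple of
   [n ^ (alpha / (beta * t1))], whereas the target only allows
   [n ^ (1 / t2)] for one of them. *)
Lemma no_distorted_map (M1 M2 : metricType R) (t1 t2 alpha beta : R)
    (f : M1 -> M2) (A B : R) :
  stretched_cubes M1 t1 -> antipodal_bound M2 t2 ->
  0 < t1 -> 0 < t2 -> 0 < alpha -> 0 < beta -> 0 < A -> 0 < B ->
  (forall x y, A^-1 * mdist x y `^ alpha <= mdist (f x) (f y) `^ beta /\
     mdist (f x) (f y) `^ beta <= B * mdist x y `^ alpha) ->
  t1 / t2 < alpha / beta -> False.
Proof.
move=> cubes [C C0 HC] t1_0 t2_0 a0 b0 A0 B0 fAB tt.
pose e := alpha / beta / t1 - t2^-1.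
have e0 : 0 < e by rewrite /e subr_gt0 ltr_pdivlMr// mulrC.
have [n n0 nP] := powR_unbounded (C * B `^ beta^-1 * A `^ beta^-1) e0.
have [F [Fedge Fdiag]] := cubes n n0.
have bi0 : 0 <= beta^-1 by rewrite invr_ge0 ltW.
have [|s1 s2|s sn sP] := HC n n0 (B `^ beta^-1) (f \o F).
- exact: powR_ge0.
- have [_ fle] := fAB (F (s1 ++ true :: s2)) (F (s1 ++ false :: s2)).
  apply: powR_le_root => //; [exact: mdist_ge0|exact: ltW|].
  apply: le_trans fle _; rewrite ler_piMr ?(ltW B0)//.
  by have := powR_le (ltW a0) (mdist_ge0 _ _) (Fedge s1 s2); rewrite powR1.
have [fge _] := fAB (F s) (F (map negb s)).
set D := mdist (f _) _ in fge sP; have D0 : 0 <= D by exact: mdist_ge0.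
have nD : n%:R `^ (alpha / t1) <= A * D `^ beta :> R.
  rewrite -ler_pdivrMl//; apply: le_trans fge.
  rewrite ler_pM2l ?invr_gt0// mulrC powRrM.
  by apply: powR_le; [exact: ltW|exact: powR_ge0|exact: Fdiag].
have := powR_le bi0 (powR_ge0 _ _) nD.
rewrite powRM ?powR_ge0 ?(ltW A0)// -!powRrM divff ?gt_eqF// (powRr1 D0).
have -> : alpha / t1 / beta = e + t2^-1 by rewrite /e subrK mulrAC.
have n0' : 0 < n%:R :> R by rewrite ltr0n.
rewrite powRD; last by rewrite (gt_eqF n0') implybT.
move=> nAD; have {nAD} := le_trans nAD (ler_wpM2l (powR_ge0 _ _) sP).
by rewrite mulrA ler_pM2r ?powR_gt0// leNgt mulrC nP.
Qed.

Lemma no_snowflake_embedding (M1 M2 : metricType R) (t1 t2 alpha beta : R)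
    (alpha_gt0 : 0 < alpha) (alpha_le1 : alpha <= 1)
    (beta_gt0 : 0 < beta) (beta_le1 : beta <= 1) :
  stretched_cubes M1 t1 -> antipodal_bound M2 t2 -> 0 < t1 -> 0 < t2 ->
  t1 / t2 < alpha / beta ->
  ~ lipschitz_embeds (snowflake alpha_gt0 alpha_le1 M1)
                     (snowflake beta_gt0 beta_le1 M2).
Proof.
move=> cubes anti t1_0 t2_0 tt [f _ [A [B [A0 B0 fAB]]]].
by apply: (@no_distorted_map M1 M2 t1 t2 alpha beta f A B).
Qed.

Lemma NS_T_of_type (M : metricType R) (t : R) : 0 < t ->
  stretched_cubes M t -> antipodal_bound M t -> NS_T M.
Proof.
move=> t0 cubes anti s s0 s1 [f _ [A [B [A0 B0 fAB]]]].
apply: (@no_distorted_map M M t t 1 s f A B) => //.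
  by move=> x y; rewrite powRr1 ?mdist_ge0//; exact: fAB.
by rewrite divff ?gt_eqF// ltr_pdivlMr// mul1r.
Qed.

End obstruction.

(** * Snowflakes of ell_p and L_q *)

Theorem theorem5p5 (R : realType) :
  (forall (p q : R) (p_gt0 : 0 < p) (q_gt0 : 0 < q)
      (alpha beta : R) (alpha_gt0 : 0 < alpha) (alpha_le1 : alpha <= 1)
      (beta_gt0 : 0 < beta) (beta_le1 : beta <= 1),
    tau p / tau q < alpha / beta ->
    ~ lipschitz_embeds (snowflake alpha_gt0 alpha_le1 (ellp p_gt0))
                       (snowflake beta_gt0 beta_le1 (Lp q_gt0)))
  /\
  (forall (p : R) (p_gt0 : 0 < p), NS_T (Lp p_gt0) /\ NS_T (ellp p_gt0)).
Proof.
split=> [p q p0 q0 alpha beta a0 a1 b0 b1 tt|p p0].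
  apply: no_snowflake_embedding tt; try exact: tau_gt0.
  - exact: stretched_cubes_lpN (ellp_contains_lpN p0).
  - exact: Lp_antipodal_bound.
split; apply: (NS_T_of_type (tau_gt0 p)).
- exact: stretched_cubes_lpN (Lp_contains_lpN p0).
- exact: Lp_antipodal_bound.
- exact: stretched_cubes_lpN (ellp_contains_lpN p0).
- exact: ellp_antipodal_bound.
Qed.
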